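(* Let $\mathcal G$ be a Farey-indexed real Markov topograph that is, or is a sign variant of, a topograph with all regions $\ge2$ having an edge well or a vertex well (so that $D<4$). Then $P_{\mathcal G}$ extends uniquely to a continuous, closed, polar curve about the origin. This curve is $\Gamma_{\mathcal G}$ and it is strictly convex.
   Context: A real Markov topograph $\mathcal G$ is an infinite 3-regular tree drawn in the plane, with a real label on every complementary region, such that for every edge, with regions $s,t$ on its two sides and regions $r,u$ at its two ends, $r+u=st$. The discriminator is $D=r^2+s^2+t^2-rst$ for the labels meeting at a vertex (independent of the vertex). An edge with end regions $r,u$, directed from $r$ to $u$, has label $u-r$; its positive direction makes the label positive. If all regions are $\ge2$: a vertex well is a vertex all of whose edges are positively directed out from it; an edge well is a $0$-labeled edge whose two side regions are both $>2$. Sign variants: the regions have a 3-colouring (unique up to permuting colours) in which adjacent regions have different colours; a sign variant is obtained by picking two colours and changing the signs of all regions with those colours. Farey indexing: regions are indexed by $\mathbb P^1(\mathbb Q)$, elements written $k/n$ with $\gcd(k,n)=1$, $k/n=(-k)/(-n)$, including $1/0$. One chooses a vertex whose three regions in clockwise order are $(s,u,t)$ and sets $m^*_{1/0}=s$, $m^*_{1/1}=u$, $m^*_{0/1}=t$; if $k/n,k'/n'$ index the two regions on the sides of an edge then the regions at its ends have indices $(k+k')/(n+n')$ and $(k-k')/(n-n')$. $m^*_{k/n}$ is the label of region $k/n$; set $r=m^*_{-1/1}=st-u$. Let $\rho(x)=\cosh^{-1}(x/2)$ for $x\ge2$ and $$P_{\mathcal G}=\left\{\left(\frac n{\rho(|m^*_{k/n}|)},\frac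 k{\rho(|m^*_{k/n}|)}\right): k,n\in\mathbb Z,\ \gcd(k,n)=1\right\}.$$ For $k/n\in\mathbb Q\cap[0,1]$ in lowest terms ($n\ge1$) put $\phi_0(k/n)=\rho(|m^*_{n/k}|)/n$, $\phi_1(k/n)=\rho(|m^*_{k/n}|)/n$, $\phi_2(k/n)=\rho(|m^*_{-k/n}|)/n$, $\phi_3(k/n)=\rho(|m^*_{-n/k}|)/n$ (with $m^*_{n/k}=m^*_{-n/k}=m^*_{1/0}$ when $k/n=0/1$). These extend uniquely to continuous functions $\Phi_0,\Phi_1,\Phi_2,\Phi_3$ on $[0,1]$ (they are the encoding functions of the Markov trees with base triples $(s,su-t,u)$, $(t,ut-s,u)$, $(t,rt-s,r)$, $(s,rs-t,r)$ respectively, after sign changes). The lattice curve is $$\Gamma_{\mathcal G}=\pm\left\{\frac{(x,1)}{\Phi_0(x)},\ \frac{(1,x)}{\Phi_1(x)},\ \frac{(-1,x)}{\Phi_2(x)},\ \frac{(x,-1)}{\Phi_3(x)} : x\in[0,1]\right\}.$$ A polar curve about the origin is a set $\{R(\theta)(\cos\theta,\sin\theta):\theta\in\mathbb R/2\pi\mathbb Z\}$ with $R>0$; it is continuous if $R$ is. It is strictly convex if the region it encloses is strictly convex (it bulges outward from the origin, every open secant segment lying in the interior of the enclosed region). *)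

(* Defs.v *)
From HB Require Import structures.
From mathcomp Require Import all_boot all_order all_algebra.
From mathcomp Require Import all_classical all_reals all_analysis.
From mathcomp Require Import ring.

Set Implicit Arguments.
Unset Strict Implicit.
Unset Printing Implicit Defensive.

Import Order.TTheory GRing.Theory Num.Theory.
Import numFieldNormedType.Exports.

Local Open Scope classical_set_scope.
Local Open Scope ring_scope.

(** * Farey-indexed Markov topographs

   The regions of the planar 3-regular tree are identified with their Farey
   indices, i.e. with the points of P^1(Q): [Some q] is the rational [q] and
   [None] is 1/0. *)

Definition region : Type := option rat.

Definition reg (k n : int) : region :=
  if n == 0 then None else Some (k%:~R / n%:~R).

(* The regions k/n and k'/n' lie on the two sides of an edge of the tree.  The
   regions at its ends are then (k+k')/(n+n') and (k-k')/(n-n'); changing the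
   sign of one of the representatives (k, n), (k', n') exchanges the two ends.
   The end of the edge at (k+k')/(n+n') is a vertex, where the regions k/n,
   k'/n', (k+k')/(n+n') meet; every edge and every vertex is of this form. *)
Definition farey (k n k' n' : int) : Prop := `|k * n' - k' * n| = 1.

Section Topograph.
Context {R : realType}.
Implicit Type m : region -> R.

Definition markov_topograph m : Prop :=
  forall k n k' n' : int, farey k n k' n' ->
    m (reg (k + k') (n + n')) + m (reg (k - k') (n - n')) =
    m (reg k n) * m (reg k' n').

(* At the vertex with regions k/n, k'/n', (k+k')/(n+n'). *)
Definition discriminator m (k n k' n' : int) : R :=
  let r := m (reg k n) in
  let s := m (reg k' n') in
  let t := m (reg (k + k') (n + n')) in
  r ^+ 2 + s ^+ 2 + t ^+ 2 - r * s * t.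

(* The label of the edge between k/n and k'/n', directed from its end at
   (k+k')/(n+n') to its end at (k-k')/(n-n'). *)
Definition edge_label m (k n k' n' : int) : R :=
  m (reg (k - k') (n - n')) - m (reg (k + k') (n + n')).

(* The vectors a = (k, n), b = (k', n') and c = - (a + b) represent the regions
   at the vertex and have sum 0, so the edges between a and b, b and c, c and a
   directed out from it are labelled as below. *)
Definition vertex_well m (k n k' n' : int) : Prop :=
  [/\ farey k n k' n',
      0 < edge_label m k n k' n',
      0 < edge_label m k' n' (- (k + k')) (- (n + n')) &
      0 < edge_label m (- (k + k')) (- (n + n')) k n].

Definition edge_well m (k n k' n' : int) : Prop :=
  [/\ farey k n k' n', edge_label m k n k' n' = 0,
      2 < m (reg k n) & 2 < m (reg k' n')].

Definition has_well m : Prop :=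
  (exists k n k' n' : int, edge_well m k n k' n') \/
  (exists k n k' n' : int, vertex_well m k n k' n').

Definition proper_colouring (c : region -> 'I_3) : Prop :=
  forall k n k' n' : int, farey k n k' n' -> c (reg k n) <> c (reg k' n').

(* [m'] is obtained from [m] by changing the signs on two of the colours. *)
Definition sign_variant m m' : Prop :=
  exists (c : region -> 'I_3) (i j : 'I_3),
    [/\ proper_colouring c, i != j &
        forall p, m' p = if (c p == i) || (c p == j) then - m p else m p].

(** * The points P and the lattice curve *)

Definition cosh (y : R) : R := (expR y + expR (- y)) / 2.

Definition rho (x : R) : R := ln (x / 2 + Num.sqrt ((x / 2) ^+ 2 - 1)).

Lemma rhoP (x : R) : 2 <= x -> 0 <= rho x /\ cosh (rho x) = x / 2.
Proof.
move=> x2; rewrite /rho /cosh.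
have y1 : 1 <= x / 2 by rewrite ler_pdivlMr ?ltr0n // mul1r.
move: (x / 2) y1 => y y1.
have s2 : Num.sqrt (y ^+ 2 - 1) ^+ 2 = y ^+ 2 - 1.
  by rewrite sqr_sqrtr // subr_ge0 exprn_ege1.
have s0 := sqrtr_ge0 (y ^+ 2 - 1).
move: (Num.sqrt _) s2 s0 => s s2 s0.
have z1 : 1 <= y + s by rewrite (le_trans y1) // lerDl.
have z0 : 0 < y + s by rewrite (lt_le_trans ltr01).
split; first exact: ln_ge0.
rewrite expRN lnK ?posrE //.
have -> : (y + s)^-1 = y - s.
  apply: (mulfI (lt0r_neq0 z0)); rewrite divff ?lt0r_neq0 //.
  by rewrite mulrC -subr_sqr s2 opprB addrC subrK.
by field.
Qed.

Definition topograph_points m : set (R * R) :=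
  [set p | exists k n : int, coprimez k n /\
     p = (n%:~R / rho `|m (reg k n)|, k%:~R / rho `|m (reg k n)|)].

(* In lowest terms, q = numq q / denq q with 0 < denq q. *)
Definition phi0 m (q : rat) : R :=
  rho `|m (reg (denq q) (numq q))| / (denq q)%:~R.
Definition phi1 m (q : rat) : R :=
  rho `|m (reg (numq q) (denq q))| / (denq q)%:~R.
Definition phi2 m (q : rat) : R :=
  rho `|m (reg (- numq q) (denq q))| / (denq q)%:~R.
Definition phi3 m (q : rat) : R :=
  rho `|m (reg (- denq q) (numq q))| / (denq q)%:~R.

End Topograph.

Section Curves.
Context {R : realType}.

(* [F] is a continuous extension to the real interval [0, 1] of the function
   [f] on its rational points. *)
Definition continuous_extension (f : rat -> R) (F : R -> R) : Prop :=
  {within `[0, 1], continuous F} /\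
  (forall q : rat, 0 <= q <= 1 -> F (ratr q) = f q).

Definition unique_continuous_extension (f : rat -> R) (F : R -> R) : Prop :=
  continuous_extension f F /\
  (forall G : R -> R, continuous_extension f G -> {in `[0, 1], G =1 F}).

Definition lattice_curve (F0 F1 F2 F3 : R -> R) : set (R * R) :=
  let half :=
    [set (x / F0 x, 1 / F0 x) | x in `[0, 1]] `|`
    [set (1 / F1 x, x / F1 x) | x in `[0, 1]] `|`
    [set (- 1 / F2 x, x / F2 x) | x in `[0, 1]] `|`
    [set (x / F3 x, - 1 / F3 x) | x in `[0, 1]] in
  half `|` [set - p | p in half].

(* About the origin; the periodicity of [r] makes the curve closed. *)
Definition continuous_polar_curve (C : set (R * R)) : Prop :=
  exists r : R -> R,
    [/\ forall t, 0 < r t, forall t, r (t + 2 * pi) = r t, continuous r &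
        C = [set (r t * cos t, r t * sin t) | t in [set: R]]].

(* The region enclosed by a polar curve about the origin. *)
Definition enclosed (C : set (R * R)) : set (R * R) :=
  [set p | exists2 c, C c & exists2 l : R, 0 <= l <= 1 & p = l *: c].

Definition strictly_convex_set (K : set (R * R)) : Prop :=
  forall p q : R * R, K p -> K q -> p <> q ->
  forall l : R, 0 < l < 1 -> interior K (l *: p + (1 - l) *: q).

Definition strictly_convex_curve (C : set (R * R)) : Prop :=
  strictly_convex_set (enclosed C).

End Curves.

(* Main.v *)
Require Import Defs.
From mathcomp Require Import all_boot all_order all_algebra.
From mathcomp Require Import all_classical all_reals all_analysis.
From mathcomp Require Import zify ring lra.
Import Order.TTheory GRing.Theory Num.Theory.
Import numFieldNormedType.Exports.
Local Open Scope classical_set_scope.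
Local Open Scope ring_scope.

(** Write [N k n = rho (m0 (k/n))].  Along a region with [N = a] the labels are
   [al e^(ja) + be e^(-ja)], and [D < 4] says that [al * be > 1]; hence
   [N (j p - q) + N q > j N p] for every basis [p, q] of the lattice.  These
   local convexity inequalities propagate along the Farey tree: for each
   primitive [v] there are linear functionals [l] and a constant [c > 0] with
   [l v = N v] and [N w >= l w + c |det (v, w)|] for all primitive [w].
   Therefore the supremum of the linear functionals below [N] is a norm on the
   plane that extends [N] and has a kink in every rational direction.  The curve
   is its unit sphere; it is strictly convex because the cone spanned by two
   independent points contains a rational direction, where the kink makes the
   triangle inequality strict. *)

Lemma normz_mul_eq1 (x y : int) :
  `|x * y| = 1 -> (x = 1 \/ x = -1) /\ (y = 1 \/ y = -1).
Proof.
move=> h; have /eqP : (`|x| * `|y| = 1)%N by rewrite -abszM; lia.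
by rewrite muln_eq1 => /andP[/eqP ? /eqP ?]; lia.
Qed.

(** * The discriminator: independence of the vertex, and the bound 4 forced by a well *)

Section Labels.
Context {R : realType}.
Implicit Types (m : region -> R) (M : int -> int -> R).

Lemma regN k n : reg (- k) (- n) = reg k n.
Proof.
rewrite /reg oppr_eq0; case: eqVneq => // n0.
by rewrite !rmorphN /= invrN mulrNN.
Qed.

Lemma farey_sym k n k' n' : farey k n k' n' -> farey k' n' k n.
Proof. by rewrite /farey distrC. Qed.

Lemma fareyN k n k' n' : farey k n k' n' -> farey k n (- k') (- n').
Proof. by rewrite /farey mulrN mulNr -opprD normrN. Qed.

Lemma farey_add k n k' n' j :
  farey k n k' n' -> farey k n (k' + j * k) (n' + j * n).
Proof. by rewrite /farey => <-; congr (`| _ |); ring. Qed.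

Lemma farey_addl k n k' n' : farey k n k' n' -> farey k' n' (k + k') (n + n').
Proof. by move=> /farey_sym/(farey_add _ _ _ _ 1); rewrite !mul1r. Qed.

Lemma farey_coprime k n k' n' : farey k n k' n' -> coprimez k n.
Proof.
rewrite /farey => h; apply/coprimezP.
have [e|e] : k * n' - k' * n = 1 \/ k * n' - k' * n = - 1 by lia.
- by exists (n', - k') => /=; lia.
- by exists (- n', k') => /=; lia.
Qed.

Lemma coprime_farey k n :
  coprimez k n -> exists k' n', k * n' - k' * n = 1.
Proof.
by move=> /coprimezP[[u v] /= h]; exists (- v), u; lia.
Qed.

Lemma edge_labelN m k n k' n' : markov_topograph m -> farey k n k' n' ->
  edge_label m k n k' n' =
  m (reg k n) * m (reg k' n') - m (reg (k + k') (n + n')) *+ 2.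
Proof.
by move=> T h; rewrite /edge_label -(T _ _ _ _ h) mulr2n; ring.
Qed.

Lemma discriminator_sym m k n k' n' :
  discriminator m k n k' n' = discriminator m k' n' k n.
Proof. by rewrite /discriminator (addrC k) (addrC n); ring. Qed.

(** Crossing the edge replaces the third label [t] by [r * s - t], the other root of the same monic
    quadratic, so the discriminator does not change. *)
Lemma discriminatorN m k n k' n' : markov_topograph m -> farey k n k' n' ->
  discriminator m k n (- k') (- n') = discriminator m k n k' n'.
Proof.
move=> T h; rewrite /discriminator regN.
have -> : m (reg (k - k') (n - n')) =
  m (reg k n) * m (reg k' n') - m (reg (k + k') (n + n')).
  by rewrite -T //; ring.
by ring.
Qed.

(** With [p = (k, n)] and [q = (k', n')], crossing the edge between [p] and [p + q] leads back to
    [q], so both sides are read off at the vertex of [p], [q], [p + q]. *)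
Lemma discriminator_add1 m k n k' n' : markov_topograph m ->
  farey k n k' n' ->
  discriminator m k n (k' + k) (n' + n) = discriminator m k n k' n'.
Proof.
move=> T h.
have h' : farey k n (k' + k) (n' + n).
  by have := farey_add _ _ _ _ 1 h; rewrite !mul1r.
rewrite -discriminatorN // /discriminator regN !opprD.
rewrite !(addrCA _ (- k')) !(addrCA _ (- n')) !subrr !addr0 regN.
by rewrite (addrC k') (addrC n'); ring.
Qed.

Lemma discriminator_add m k n k' n' j : markov_topograph m ->
  farey k n k' n' ->
  discriminator m k n (k' + j * k) (n' + j * n) = discriminator m k n k' n'.
Proof.
move=> T; suff P (i : nat) k1 n1 : farey k n k1 n1 ->
  discriminator m k n (k1 + i%:Z * k) (n1 + i%:Z * n) =
  discriminator m k n k1 n1.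
  move=> h; case: (intP j) => [|i|i]; first by rewrite !mul0r !addr0.
    exact: P.
  have := P i.+1 _ _ (farey_add _ _ _ _ (- i.+1%:Z) h).
  by rewrite !mulNr !subrK.
elim: i => [|i IH] h; first by rewrite !mul0r !addr0.
rewrite -IH // -[RHS]discriminator_add1 //; last exact: farey_add.
by congr discriminator; lia.
Qed.

(** Euclid's algorithm on the first coordinates: a multiple of [(k, n)] reduces [k'] modulo [k],
    then the two vectors are exchanged. At [k = 0] both [n] and [k'] are units, and only signs and a
    shift of [n'] remain. *)
Lemma discriminator_const m k n k' n' : markov_topograph m ->
  farey k n k' n' -> discriminator m k n k' n' = discriminator m 0 1 1 0.
Proof.
move=> T; have [i] := ubnP `|k|%N; elim: i => // i IH in k n k' n' *.
move=> ki h; have [k0|k0] := eqVneq k 0.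
  subst k; move: h; rewrite /farey mul0r sub0r normrN => h.
  have hb : farey 0 1 1 0 by [].
  have hN : farey 0 1 (-1) 0 by [].
  have D1 l : discriminator m 0 1 1 l = discriminator m 0 1 1 0.
    have := discriminator_add _ _ _ _ _ l T hb.
    by rewrite mulr0 mulr1 add0r addr0.
  have D2 l : discriminator m 0 1 (-1) l = discriminator m 0 1 1 0.
    rewrite -(D1 (- l)) -discriminatorN ?opprK //.
    by rewrite /farey; lia.
  have D3 x y : discriminator m 0 (-1) x y = discriminator m 0 1 (- x) (- y).
    rewrite /discriminator -(regN 0 (-1)) -(regN x) oppr0 opprK.
    by rewrite -(regN (0 + x)) !opprD oppr0 opprK.
  have [[]-> []->] := normz_mul_eq1 _ _ h; rewrite ?D3 ?opprK.
  all: rewrite ?D1 ?D2 //.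
rewrite -(discriminator_add _ _ _ _ _ (- (k' %/ k)%Z)) //.
rewrite discriminator_sym; apply: IH; last first.
  exact/farey_sym/farey_add.
move: (divz_eq k' k) (modz_ge0 k' k0) (ltz_mod k' k0).
by lia.
Qed.

(** The discriminator decreases in [t] up to [r * s / 2], so it is at most its value at [t = r],
    which equals [4 - (s - 2) * (r ^+ 2 - s - 2)]. The case [s = 2] is excluded because it would
    give [t < r]. *)
Lemma discriminator_lt4_sorted (r s t : R) :
  2 <= s -> s <= r -> r <= t -> t *+ 2 < r * s ->
  r ^+ 2 + s ^+ 2 + t ^+ 2 - r * s * t < 4.
Proof.
rewrite mulr2n => s2 sr rt h.
have s3 : 2 < s by rewrite lt_neqAle s2 andbT; apply/eqP => e; nra.
have h1 : 0 <= (t - r) * (r * s - t - r) by apply: mulr_ge0; lra.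
have h2 : s ^+ 2 <= r ^+ 2 by rewrite expr2; nra.
have h3 : 0 < (s - 2) * (r ^+ 2 - s - 2) by apply: mulr_gt0; nra.
by nra.
Qed.

Lemma vertex_well_lt4 (r s t : R) : 2 <= r -> 2 <= s -> 2 <= t ->
  t *+ 2 < r * s -> r *+ 2 < s * t -> s *+ 2 < t * r ->
  r ^+ 2 + s ^+ 2 + t ^+ 2 - r * s * t < 4.
Proof.
move=> r2 s2 t2 ht hr hs; have S := discriminator_lt4_sorted.
have [sr|/ltW rs] := leP s r; have [rt|/ltW tr] := leP r t;
  have [st|/ltW ts] := leP s t.
- exact: S.
- by have := S r s t s2 sr rt ht.
- by have := S t s r s2 st tr; rewrite (mulrC t s) => /(_ hr); lra.
- by have := S s t r t2 ts sr hr; lra.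
- by have := S s r t r2 rs st; rewrite (mulrC s r) => /(_ ht); lra.
- by have := S t r s r2 rt ts hs; lra.
- have tE : t = s by lra.
  by have := S s r t r2 rs st; rewrite (mulrC s r) => /(_ ht); lra.
- have := S r t s t2 tr rs; rewrite (mulrC r t) => /(_ hs); lra.
Qed.

Lemma well_discriminator_lt4 m : markov_topograph m ->
  (forall p, 2 <= m p) -> has_well m ->
  forall k n k' n', farey k n k' n' -> discriminator m k n k' n' < 4.
Proof.
move=> T m2 w k n k' n' h; rewrite discriminator_const //.
case: w => -[k1 [n1 [k2 [n2]]]].
- case=> h12; rewrite edge_labelN // -(discriminator_const _ k1 n1 k2 n2) //.
  rewrite /discriminator; move: (m _) (m _) (m _) => t s r /eqP.
  rewrite subr_eq0 mulr2n => /eqP e r2 s2.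
  (* At an edge well [2 * t = r * s], and this product is four times the difference between 4 and
     the discriminator. *)
  have : 0 < (r ^+ 2 - 4) * (s ^+ 2 - 4).
    have -> : 4 = 2 ^+ 2 :> R by ring.
    by apply: mulr_gt0; rewrite subr_gt0 ltr_pXn2r ?nnegrE //; lra.
  have -> : (r ^+ 2 - 4) * (s ^+ 2 - 4) =
    (r * s) ^+ 2 - 4 * r ^+ 2 - 4 * s ^+ 2 + 16 by ring.
  by rewrite e; lra.
- move=> [h12].
  have h23 := farey_addl _ _ _ _ h12.
  have h31 : farey (- (k1 + k2)) (- (n1 + n2)) k1 n1.
    apply/farey_sym/fareyN; have := farey_add _ _ _ _ 1 h12.
    by rewrite !mul1r (addrC k2) (addrC n2).
  rewrite !edge_labelN //; last exact: fareyN.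
  have e1 (x y : int) : y + - (x + y) = - x by ring.
  have e2 (x y : int) : - (x + y) + x = - y by ring.
  rewrite !e1 !e2 !regN -(discriminator_const _ k1 n1 k2 n2) // !subr_gt0.
  exact: vertex_well_lt4.
Qed.

End Labels.

(** * The function [rho] along the regions adjacent to a given region *)

Section Length.
Context {R : realType}.
Implicit Types (m : region -> R) (M : int -> int -> R).

Lemma rho_gt0 (x : R) : 2 < x -> 0 < rho x.
Proof.
move=> x2; have [r0] := rhoP (ltW x2); rewrite le0r in r0.
case/orP: r0 => // /eqP ->; rewrite /cosh oppr0 expR0; lra.
Qed.

Lemma expR_rho (x : R) : 2 <= x -> expR (rho x) + expR (- rho x) = x.
Proof. by move=> /rhoP[_]; rewrite /cosh; lra. Qed.

(** Monotonicity of [cosh] on the nonnegative reals, in the form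
    [a + b - c - d = (a - c) * (1 - b * d)] when [a * b = c * d = 1]. The number [t] may have either
    sign. *)
Lemma le_rho (t x : R) : 2 <= x -> expR t + expR (- t) <= x -> t <= rho x.
Proof.
move=> x2 h; rewrite leNgt; apply/negP => lt.
have [r0 _] := rhoP x2; have := expR_rho _ x2.
move: (rho x) r0 lt => y y0 yt e; rewrite -e in h.
have [p1 p2] : 0 < expR t /\ 0 < expR y by rewrite !expR_gt0.
have p3 : expR y < expR t by rewrite ltr_expR.
have p4 : expR (- t) * expR (- y) < 1.
  by rewrite -expRD expR_lt1; lra.
have := expRxMexpNx_1 t; have := expRxMexpNx_1 y; move: h p4.
move: (expR t) (expR (- t)) (expR y) (expR (- y)) p1 p2 p3 => a b c d.
move=> a0 c0 ca h bd cd ab.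
have : 0 < (a - c) * (1 - b * d) by apply: mulr_gt0; lra.
have -> : (a - c) * (1 - b * d) = a - c - (a * b) * d + (c * d) * b by ring.
by rewrite ab cd; lra.
Qed.

(** Labels are functions of integer vectors instead of regions, so that a change of lattice basis is
    a mere substitution; the first clause accounts for the two representatives of a region. *)
Definition hyperbolic_labels M : Prop :=
  [/\ forall k n, M (- k) (- n) = M k n,
      forall k n k' n', farey k n k' n' ->
        M (k + k') (n + n') + M (k - k') (n - n') = M k n * M k' n',
      forall k n, coprimez k n -> 2 < M k n &
      forall k n k' n', farey k n k' n' ->
        M k n ^+ 2 + M k' n' ^+ 2 + M (k + k') (n + n') ^+ 2
        - M k n * M k' n' * M (k + k') (n + n') < 4].

(** A label equal to 2 would make the discriminator [4 + (s - t) ^+ 2], which is not below 4; hence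
    the bound 2 is strict. *)
Lemma topograph_hyperbolic_labels m : markov_topograph m ->
  (forall p, 2 <= m p) -> has_well m ->
  hyperbolic_labels (fun k n => m (reg k n)).
Proof.
move=> T m2 w; have D := well_discriminator_lt4 _ T m2 w.
split => [k n||k n /coprime_farey[k' [n' e]]|].
- by rewrite regN.
- exact: T.
2: exact: D.
have h : farey k n k' n' by rewrite /farey e.
have := D _ _ _ _ h; rewrite /discriminator => lt4.
rewrite lt_neqAle m2 andbT; apply/eqP => e2; move: lt4.
rewrite -e2; move: (m _) (m _) => t s.
have -> : 2 ^+ 2 + s ^+ 2 + t ^+ 2 - 2 * s * t = 4 + (s - t) ^+ 2 by ring.
by rewrite ltNge lerDl sqr_ge0.
Qed.

(** This allows any region to be moved to 1/0: determinants are multiplied by that of the new basis,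
    which is 1 or -1. *)
Lemma hyperbolic_labels_basis M k n k' n' : hyperbolic_labels M ->
  farey k n k' n' ->
  hyperbolic_labels (fun j i => M (j * k + i * k') (j * n + i * n')).
Proof.
move=> [E T P D] h.
have F a b c d : farey a b c d -> farey (a * k + b * k') (a * n + b * n')
    (c * k + d * k') (c * n + d * n').
  rewrite /farey => e.
  by rewrite -[RHS]mulr1 -{1}e -h -normrM; congr (`| _ |); ring.
split=> [a b|a b c d /F e|a b /coprime_farey[c [d e]]|a b c d /F e].
- by rewrite -E; congr M; ring.
- rewrite -T //; congr (_ + _); congr M; ring.
- have /F/farey_coprime : farey a b c d by rewrite /farey e.
  exact: P.
- have := D _ _ _ _ e; congr (_ + _ ^+ 2 - _ * _ < _); congr M; ring.
Qed.

Lemma linear_recurrence_eq (c : R) (f g : int -> R) :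
  (forall j, f (j + 1) + f (j - 1) = c * f j) ->
  (forall j, g (j + 1) + g (j - 1) = c * g j) ->
  f 0 = g 0 -> f 1 = g 1 -> f =1 g.
Proof.
move=> rf rg e0 e1.
have up (i : nat) : f i%:Z = g i%:Z /\ f i.+1%:Z = g i.+1%:Z.
  elim: i => [//|i [h1 h2]]; split => //.
  have := rf i.+1%:Z; have := rg i.+1%:Z.
  have -> : i.+1%:Z + 1 = i.+2%:Z by lia.
  have -> : i.+1%:Z - 1 = i%:Z by lia.
  by rewrite h1 h2; lra.
have dn (i : nat) : f (- i%:Z) = g (- i%:Z) /\ f (1 - i%:Z) = g (1 - i%:Z).
  elim: i => [|i [h1 h2]]; first by rewrite oppr0 subr0.
  have -> : 1 - i.+1%:Z = - i%:Z by lia.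
  split => //; have := rf (- i%:Z); have := rg (- i%:Z).
  have -> : - i%:Z + 1 = 1 - i%:Z by lia.
  have -> : - i%:Z - 1 = - i.+1%:Z by lia.
  by rewrite h1 h2; lra.
by move=> j; case: (intP j) => [//|i|i]; [case: (up i) | case: (dn i.+1)].
Qed.

(* The labels along the region 1/0 are [al e^(ja) + be e^(-ja)], and D < 4 says
   exactly that [al * be > 1]. *)
Lemma rho_ray M : hyperbolic_labels M ->
  exists A B : R, 0 < A + B /\ forall j : int,
    rho (M 1 0) * j%:~R + A <= rho (M j 1) /\
    - rho (M 1 0) * j%:~R + B <= rho (M j 1).
Proof.
move=> [E T P D].
have M2 : 2 < M 1 0 by apply: P.
have a0 := rho_gt0 _ M2; set a := rho _ in a0 *.
have Ma : expR a + expR (- a) = M 1 0 := expR_rho _ (ltW M2).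
have Mj j : 2 < M j 1 by apply: P; rewrite coprimezE coprimen1.
have rec j : M (j + 1) 1 + M (j - 1) 1 = M 1 0 * M j 1.
  have h : farey j 1 1 0 by rewrite /farey; lia.
  by rewrite mulrC -T // addr0 subr0.
set x := expR a in Ma *; set y := expR (- a) in Ma *.
have xy : x * y = 1 by apply: expRxMexpNx_1.
have y0 : 0 < y by apply: expR_gt0.
have x1 : 1 < x by rewrite expR_gt1.
have y1 : y < 1 by nra.
have d0 : x - y != 0 by apply/eqP; lra.
(* [al] and [be] solve [al + be = M 0 1] and [al * x + be * y = M 1 1], the two initial values of
   the recurrence. *)
pose al := (M 1 1 - y * M 0 1) / (x - y).
pose be := (x * M 0 1 - M 1 1) / (x - y).
have xj (j : int) : expR (a * (j + 1)%:~R) = expR (a * j%:~R) * x.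
  by rewrite -expRD intrD mulrDr mulr1.
have xj' (j : int) : expR (a * (j - 1)%:~R) = expR (a * j%:~R) * y.
  by rewrite -expRD intrD mulrDr mulrN1.
have yj (j : int) : expR (- a * (j + 1)%:~R) = expR (- a * j%:~R) * y.
  by rewrite -expRD intrD mulrDr mulr1.
have yj' (j : int) : expR (- a * (j - 1)%:~R) = expR (- a * j%:~R) * x.
  by rewrite -expRD intrD mulrDr mulrN1 opprK.
have ME j : M j 1 = al * expR (a * j%:~R) + be * expR (- a * j%:~R).
  pose g j := al * expR (a * j%:~R) + be * expR (- a * j%:~R).
  apply: (linear_recurrence_eq (M 1 0) (M^~ 1) g) => // [i||].
  - by rewrite /g xj xj' yj yj' -Ma; ring.
  - by rewrite /g !mulr0 expR0 /al /be; field.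
  - by rewrite /g !mulr1 -/x -/y /al /be; field.
have D1 := D 1 0 0 1 erefl.
have albe : 1 < al * be.
  have -> : al * be = ((M 1 1 - y * M 0 1) * (x * M 0 1 - M 1 1))
      / (x - y) ^+ 2 by rewrite /al /be; field.
  rewrite ltr_pdivlMr; last by rewrite exprn_even_gt0.
  move: D1; rewrite -Ma add0r addr0.
  move: (M 0 1) (M 1 1) => s t.
  have -> : (t - y * s) * (x * s - t) =
    (x + y) * s * t - t ^+ 2 - (x * y) * s ^+ 2 by ring.
  have -> : (x - y) ^+ 2 = (x + y) ^+ 2 - 4 * (x * y) by ring.
  by rewrite xy; lra.
have abp : 0 < al + be.
  by have := ME 0; have := Mj 0; rewrite !mulr0 expR0 !mulr1; lra.
have al0 : 0 < al by nra.
have be0 : 0 < be by nra.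
exists (ln al), (ln be); split.
  by rewrite -lnM ?posrE // ln_gt0.
(* Since [u^-1 < v], [z] is at least [expR w + expR (- w)] for [w = t + ln u]. *)
have bound (u v t z : R) : 0 < u -> 1 < u * v ->
    z = u * expR t + v * expR (- t) -> 2 < z -> t + ln u <= rho z.
  move=> u0 uv zE z2; apply: le_rho; first exact: ltW.
  rewrite opprD !expRD (expRN (ln u)) lnK ?posrE // zE.
  rewrite (mulrC (expR t)) lerD2l mulrC ler_pM2r ?expR_gt0 //.
  by rewrite -div1r ler_pdivrMr // mulrC ltW.
move=> j; split.
  by apply: (bound _ be); rewrite // ME mulNr.
apply: (bound _ al) => //; first by rewrite mulrC.
by rewrite ME mulNr opprK addrC.
Qed.

End Length.

(** * Supporting functionals by Euclidean descent in the Farey tree *)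

Section Support.
Context {R : realType}.
Implicit Type M : int -> int -> R.

(** In the basis [(k, n)], [(- k', - n')], the bound of [rho_ray] with [A] at [j] and the one with
    [B] at 0 are added; the excess [A + B] is positive. *)
Lemma rho_local_convex M k n k' n' j : hyperbolic_labels M ->
  k * n' - k' * n = 1 ->
  j%:~R * rho (M k n) <= rho (M (j * k - k') (j * n - n')) + rho (M k' n').
Proof.
move=> H e; have [E _ _ _] := H.
have h : farey k n (- k') (- n') by apply: fareyN; rewrite /farey e.
have [A [B [AB ray]]] := rho_ray _ (hyperbolic_labels_basis _ _ _ _ _ H h).
have [+ _] := ray j; have [_] := ray 0.
rewrite !(mul0r, mul1r, add0r, addr0, mulr0) E; lra.
Qed.

(* By local convexity, [g k' i' * i - g k i * i'] does not increase when the basis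
   [p = (k, i), p' = (k', i')] is replaced by [q p - p', p]; choosing [q] so that
   the second coordinate of [q p - p'] is [(- i') mod i] gives a descent to
   [i = 0], where [p = +- (1, 0)]. *)
Lemma rho_slope_le M (i : nat) k k' i' : hyperbolic_labels M ->
  let g j n := rho (M j n) - rho (M 1 0) * j%:~R in
  k * i' - k' * i%:Z = 1 -> g k i%:Z * i'%:~R <= g k' i' * i%:R.
Proof.
move=> H g; have [E _ P _] := H.
have a0 := rho_gt0 _ (P 1 0 isT).
have [N] := ubnP i; elim: N => // N IH in i k k' i' *.
move=> iN e; have [i0|i0] := posnP i.
  subst i; rewrite mulr0 subr0 in e; rewrite mulr0.
  have h : `|k * i'| = 1 by rewrite e.
  have [[]ek []ei] := normz_mul_eq1 _ _ h; subst k i'; move: e => // _.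
    by rewrite /g !mulr1z; lra.
  (* For [k = i' = -1] the left side is [- 2 * rho (M 1 0)], and positivity of [rho] concludes. *)
  have E1 : M (-1) 0%N = M 1 0 := E 1 0.
  by rewrite /g E1 !mulrN1z; lra.
pose q := - ((- i') %/ i%:Z)%Z.
have i0' : i%:Z != 0 by lia.
have := divz_eq (- i') i%:Z; have := modz_ge0 (- i') i0'.
have := ltz_mod (- i') i0'; set r := modz _ _ => r1 r0 r2.
have rE : r = q * i%:Z - i' by rewrite /q; lia.
have [r' er'] : exists r' : nat, r = r'%:Z by exists `|r|%N; lia.
have e' : (q * k - k') * i%:Z - k * r' = 1 by rewrite -er' rE -e; ring.
have r'N : (r' < N)%N by lia.
have := IH r' (q * k - k') k i r'N e'.
have := rho_local_convex _ _ _ _ _ q H e.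
rewrite -rE er' /g /= => h1 h2.
have rR : r'%:R = q%:~R * i%:R - i'%:~R :> R.
  by rewrite -[LHS]/(r'%:Z%:~R) -er' rE intrB intrM.
rewrite rR intrB intrM in h2; move: h1 h2.
have : 0 < i%:R :> R by rewrite ltr0n.
move: (rho (M _ r')) (rho (M k i)) (rho (M k' i')) => X Y Z.
rewrite -!pmulrn; move: (i%:R : R) (q%:~R : R) => I Q I0 h1 h2.
have : 0 <= (X + Z - Q * Y) * I by rewrite mulr_ge0 ?subr_ge0 // ltW.
by move: h2; lra.
Qed.

(** By [rho_slope_le], the slope [(rho (M j i) - rho (M 1 0) * j) / i] is at least that of a Farey
    neighbour with smaller positive second coordinate; the descent ends at [i = 1], where the bound
    is assumed. *)
Lemma rho_ge_upper M (A : R) (i : nat) (j : int) : hyperbolic_labels M ->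
  (forall j : int, rho (M 1 0) * j%:~R + A <= rho (M j 1)) ->
  (0 < i)%N -> coprimez j i%:Z ->
  rho (M 1 0) * j%:~R + A * i%:R <= rho (M j i%:Z).
Proof.
move=> H base; have [N] := ubnP i; elim: N => // N IH in i j *.
move=> iN i0 /coprimezP[[u v] /= e].
have i0' : i%:Z != 0 by lia.
(* Among the vectors having determinant 1 with [(j, i)], this quotient selects the one whose second
   coordinate [r] lies between 0 and [i - 1]. *)
pose t := ((- u) %/ i%:Z)%Z.
have := divz_eq (- u) i%:Z; have := modz_ge0 (- u) i0'.
have := ltz_mod (- u) i0'; set r := modz _ _ => r1 r0 r2.
have rE : r = - u - t * i%:Z by rewrite /t; lia.
have [r' er'] : exists r' : nat, r = r'%:Z by exists `|r|%N; lia.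
have e' : (v - t * j) * i%:Z - j * r' = 1 by rewrite -er' rE -e; ring.
have [r'0|r'0] := posnP r'.
  move: e'; rewrite r'0 mulr0 subr0 => e'.
  have h : `|(v - t * j) * i%:Z| = 1 by rewrite e'.
  have -> : i = 1%N by case: (normz_mul_eq1 _ _ h) => _; lia.
  by rewrite mulr1; apply: base.
have co : coprimez (v - t * j) r'.
  by apply: (@farey_coprime _ _ j i); rewrite /farey e'.
have := IH r' (v - t * j) _ r'0 co; have := rho_slope_le _ _ _ _ _ H e'.
rewrite -!pmulrn => h1 /(_ ltac:(lia)) h2.
have r'0' : 0 < r'%:R :> R by rewrite ltr0n.
have i0'' : 0 < i%:R :> R by rewrite ltr0n.
rewrite -(ler_pM2r r'0').
have : (A * r'%:R) * i%:R <= (rho (M (v - t * j) r') - rho (M 1 0) * (v - t * j)%:~R) * i%:R.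
  by rewrite ler_pM2r //; lra.
by lra.
Qed.

(* The functional is the mean of the two asymptotic ones given by [rho_ray], and
   [2 c = A + B] is their gap. *)
Lemma rho_support M k n : hyperbolic_labels M -> coprimez k n ->
  exists al be c : R, [/\ 0 < c,
    al * n%:~R + be * k%:~R = rho (M k n) &
    forall x y, coprimez x y ->
      al * y%:~R + be * x%:~R + c * `|n%:~R * x%:~R - k%:~R * y%:~R|
        <= rho (M x y)].
Proof.
move=> H co; have [E _ _ _] := H; have [k' [n' e]] := coprime_farey _ _ co.
have h : farey k n k' n' by rewrite /farey e.
have eR : k%:~R * n'%:~R - k'%:~R * n%:~R = 1 :> R.
  by rewrite -!intrM -intrB e.
pose L j i := M (j * k + i * k') (j * n + i * n').
have HL : hyperbolic_labels L := hyperbolic_labels_basis _ _ _ _ _ H h.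
(* Reversing the first basis vector handles the half plane [i < 0], because [L j (- i) = L' j i],
   and puts [B] in the place of [A]. *)
pose L' j i := M (- j * k + i * k') (- j * n + i * n').
have HL' : hyperbolic_labels L'.
  have := hyperbolic_labels_basis _ (- k) (- n) k' n' H.
  rewrite /L'; under eq_fun do under eq_fun do rewrite !mulrN -!mulNr.
  by apply; apply/farey_sym/fareyN/farey_sym.
have [A [B [AB ray]]] := rho_ray _ HL.
have a0 : L 1 0 = M k n by rewrite /L !mul1r !mul0r !addr0.
have a0' : L' 1 0 = M k n by rewrite /L' !mulN1r !mul0r !addr0.
set a := rho (M k n).
have up (i : nat) (j : int) : (0 < i)%N -> coprimez j i ->
    a * j%:~R + A * i%:R <= rho (L j i).
  rewrite /a -a0; apply: rho_ge_upper => // l; exact: (ray l).1.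
have lo (i : nat) (j : int) : (0 < i)%N -> coprimez j i ->
    a * j%:~R + B * i%:R <= rho (L' j i).
  rewrite /a -a0'; apply: rho_ge_upper => // l.
  have := (ray (- l)).2; rewrite a0 a0' /L /L' rmorphN /=.
  by rewrite mulrNN.
(* The slopes [A] for [i > 0] and [- B] for [i < 0] are combined into a mean slope plus half their
   gap times the absolute value of [i]. *)
have both j i : coprimez j i ->
    a * j%:~R + (A - B) / 2 * i%:~R + (A + B) / 2 * `|i%:~R| <= rho (L j i).
  case: (intP i) => [|l|l] co'.
  - have h' : `|j * 1| = 1 by move: co'; rewrite mulr1 coprimezE /coprime gcdn0; lia.
    have Lj : L j 0 = M k n.
      rewrite /L !mul0r !addr0.
      by have [[]-> _] := normz_mul_eq1 _ _ h'; rewrite ?mul1r ?mulN1r.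
    rewrite Lj -/a normr0 !mulr0 !addr0.
    have : 0 <= a by apply/ltW/rho_gt0; have [_ _ + _] := H; apply.
    by have [[]-> _] := normz_mul_eq1 _ _ h'; rewrite ?mulr1z ?mulrN1z; lra.
  - by have := up l.+1 j isT co'; rewrite ger0_norm ?ler0n // -!pmulrn; lra.
  - have -> : L j (- l.+1%:Z) = L' j l.+1.
      by rewrite /L /L' -E; congr M; ring.
    rewrite coprimezN in co'; have := lo l.+1 j isT co'.
    rewrite rmorphN normrN /= ger0_norm ?ler0n // -!pmulrn; lra.
(* These are the coefficients of [a * j + (A - B) / 2 * i] after substituting [j = x * n' - y * k']
   and [i = k * y - n * x]. *)
exists ((A - B) / 2 * k%:~R - a * k'%:~R), (a * n'%:~R - (A - B) / 2 * n%:~R).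
exists ((A + B) / 2); split; first by lra.
  by rewrite -[RHS]mulr1 -[in RHS]eR; ring.
move=> x y /coprimezP[[u v] /= uv].
have := both (x * n' - y * k') (k * y - n * x).
have -> : L (x * n' - y * k') (k * y - n * x) = M x y.
  rewrite /L; congr M.
    by rewrite -[RHS]mulr1 -e; ring.
  by rewrite -[RHS]mulr1 -e; ring.
have co' : coprimez (x * n' - y * k') (k * y - n * x).
  apply/coprimezP; exists (u * k + v * n, u * k' + v * n') => /=.
  have -> : 1 = (u * x + v * y) * (k * n' - k' * n) by rewrite e uv.
  by ring.
move=> /(_ co'); rewrite !intrB !intrM (distrC (n%:~R * _)).
apply: le_trans; rewrite le_eqVlt; apply/orP; left; apply/eqP; ring.
Qed.

End Support.

(** * The norm generated by the supporting functionals *)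

Section Gauge.
Context {R : realType}.
Implicit Types (N : int -> int -> R) (z w l : R * R).

(** A pair stands for a linear functional. The region k/n sits at the point [(n, k)] of the plane,
    as in the curve, so the first coefficient goes with the denominator. *)
Definition supports N : set (R * R) :=
  [set l | forall k n, coprimez k n -> l.1 * n%:~R + l.2 * k%:~R <= N k n].

(** The support function of the convex set [supports N]. *)
Definition gauge N z : R :=
  sup [set l.1 * z.1 + l.2 * z.2 | l in supports N].

(** This is all that the geometry of the curve uses about [rho] of the labels. The constant [c]
    measures how sharply the graph bends across the ray through [(n, k)]. *)
Definition kinked N : Prop :=
  [/\ forall k n, coprimez k n -> 0 < N k n,
      forall k n, N (- k) (- n) = N k n &
      forall k n, coprimez k n -> exists al be c : R, [/\ 0 < c,
        al * n%:~R + be * k%:~R = N k n &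
        forall x y, coprimez x y ->
          al * y%:~R + be * x%:~R + c * `|n%:~R * x%:~R - k%:~R * y%:~R|
            <= N x y]].

(** Together with [supports_nonempty], this bound keeps the supremum in [gauge] away from its
    default value. *)
Lemma supports_le N z l : kinked N -> supports N l ->
  l.1 * z.1 + l.2 * z.2 <= N 0 1 * `|z.1| + N 1 0 * `|z.2|.
Proof.
move=> [_ E _] lS.
have b1 : `|l.1| <= N 0 1.
  rewrite ler_norml -lerN2 opprK.
  have := lS 0 1 isT; have := lS 0 (-1) isT.
  have -> : N 0 (-1) = N 0 1 := E 0 1.
  by rewrite mulr1z mulrN1z !mulr0 !addr0 mulr1 mulrN1 => -> ->.
have b2 : `|l.2| <= N 1 0.
  rewrite ler_norml -lerN2 opprK.
  have := lS 1 0 isT; have := lS (-1) 0 isT.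
  have -> : N (-1) 0 = N 1 0 := E 1 0.
  by rewrite mulr1z mulrN1z !mulr0 !add0r mulr1 mulrN1 => -> ->.
apply: lerD; apply: (le_trans (ler_norm _)); rewrite normrM.
  exact: ler_wpM2r.
exact: ler_wpM2r.
Qed.

(** The kink leaves room to tilt the functional about the ray through [(n, k)], which gives a whole
    segment of supporting functionals. *)
Lemma kink_supports N al be c (k n : int) (s : R) : 0 < c -> `|s| <= 1 ->
  (forall x y, coprimez x y ->
    al * y%:~R + be * x%:~R + c * `|n%:~R * x%:~R - k%:~R * y%:~R| <= N x y) ->
  supports N (al - s * c * k%:~R, be + s * c * n%:~R).
Proof.
move=> c0 s1 h x y co /=; apply: le_trans (h x y co).
set d := n%:~R * _ - _.
have : s * d <= `|d|.
  by rewrite (le_trans (ler_norm _)) // normrM ler_piMl.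
move/(ler_wpM2l (ltW c0)); rewrite /d; lra.
Qed.

Lemma supports_nonempty N : kinked N -> supports N !=set0.
Proof.
move=> [_ _ /(_ 0 1 isT)[al [be [c [c0 _ h]]]]].
by exists (al - 0 * c * 0%:~R, be + 0 * c * 1%:~R); apply: kink_supports; rewrite ?normr0.
Qed.

Lemma gauge_ge N z l : kinked N -> supports N l ->
  l.1 * z.1 + l.2 * z.2 <= gauge N z.
Proof.
move=> K lS; apply: ub_le_sup; last by exists l.
exists (N 0 1 * `|z.1| + N 1 0 * `|z.2|) => _ [l' l'S <-].
exact: supports_le.
Qed.

Lemma gauge_le N z b : kinked N ->
  (forall l, supports N l -> l.1 * z.1 + l.2 * z.2 <= b) -> gauge N z <= b.
Proof.
move=> K h; apply: ge_sup => [|_ [l lS <-]]; last exact: h.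
by have [l lS] := supports_nonempty _ K; exists (l.1 * z.1 + l.2 * z.2), l.
Qed.

Lemma gaugeD N z w : kinked N -> gauge N (z + w) <= gauge N z + gauge N w.
Proof.
move=> K; apply: gauge_le => // l lS.
have := gauge_ge _ z _ K lS; have := gauge_ge _ w _ K lS.
by case: z w => [? ?] [? ?] /=; lra.
Qed.

Lemma gaugeN N z : kinked N -> gauge N (- z) = gauge N z.
Proof.
move=> K; have [_ E _] := K.
suff h w : gauge N (- w) <= gauge N w.
  by apply: le_anti; rewrite h -{1}(opprK z) h.
apply: gauge_le => // l lS.
have lS' : supports N (- l).
  move=> k n co /=; rewrite -E.
  have := lS (- k) (- n); rewrite !rmorphN /= !mulNr !mulrN; apply.
  by rewrite coprimeNz coprimezN.
by have := gauge_ge _ w _ K lS'; case: w => ? ? /=; lra.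
Qed.

Lemma gauge_ge0 N z : kinked N -> 0 <= gauge N z.
Proof.
move=> K; have [l lS] := supports_nonempty _ K.
have := gauge_ge _ z _ K lS; have := gauge_ge _ (- z) _ K lS.
by rewrite gaugeN //; case: z => ? ? /=; lra.
Qed.

Lemma gaugeZ N (t : R) z : kinked N -> gauge N (t *: z) = `|t| * gauge N z.
Proof.
move=> K.
have h (s : R) w : 0 <= s -> gauge N (s *: w) <= s * gauge N w.
  move=> s0; apply: gauge_le => // l lS.
  have := ler_wpM2l s0 (gauge_ge _ w _ K lS).
  by rewrite mulrDr !(mulrCA s).
have P (s : R) w : 0 <= s -> gauge N (s *: w) = s * gauge N w.
  move=> s0; apply: le_anti; rewrite h //=.
  have [->|sn0] := eqVneq s 0; first by rewrite mul0r gauge_ge0.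
  have sp : 0 < s by rewrite lt_neqAle eq_sym sn0.
  rewrite -{1}(scale1r w) -(mulVf sn0) -scalerA.
  have := h s^-1 (s *: w); rewrite invr_ge0 => /(_ s0).
  by rewrite ler_pdivlMl.
have [t0|t0] := leP 0 t; first by rewrite P ?ger0_norm.
by rewrite -gaugeN // -scaleNr P ?ltr0_norm // oppr_ge0 ltW.
Qed.

Lemma gauge_int N k n : kinked N -> coprimez k n ->
  gauge N (n%:~R, k%:~R) = N k n.
Proof.
move=> K co; have [_ _ /(_ k n co)[al [be [c [c0 e h]]]]] := K.
apply: le_anti; apply/andP; split.
  by apply: gauge_le => // l /(_ _ _ co).
have lS := kink_supports _ _ _ _ _ _ 0 c0 _ h.
rewrite normr0 in lS.
have := gauge_ge _ (n%:~R, k%:~R) _ K (lS ler01).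
by rewrite /= -e; lra.
Qed.

(** Dividing by the gcd [g] reduces to a primitive vector, at the cost of replacing [c] by [c / g].
    The absolute value at a real point comes from the two extreme tilts [s = 1] and [s = -1]. *)
Lemma gauge_kink N (k n : int) : kinked N -> (k, n) != (0, 0) ->
  exists al be c : R, [/\ 0 < c,
    al * n%:~R + be * k%:~R = gauge N (n%:~R, k%:~R) &
    forall z, al * z.1 + be * z.2 + c * `|n%:~R * z.2 - k%:~R * z.1|
      <= gauge N z].
Proof.
move=> K kn0; pose g := gcdz k n.
have g0 : 0 < g.
  by rewrite lt_neqAle le0z_nat andbT eq_sym gcdz_eq0; move: kn0; rewrite xpair_eqE.
have [[k1 ek] [n1 en]] : (exists k1, k = k1 * g) /\ (exists n1, n = n1 * g).
  by split; apply/dvdzP; [apply: dvdz_gcdl | apply: dvdz_gcdr].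
have co : coprimez k1 n1.
  have [u [v uv]] := Bezoutz k n.
  apply/coprimezP; exists (u, v) => /=; apply: (mulIf (lt0r_neq0 g0)).
  by rewrite mulrDl -!mulrA -ek -en uv mul1r.
have gR : 0 < g%:~R :> R by rewrite ltr0z.
have [_ _ /(_ k1 n1 co)[al [be [c [c0 e h]]]]] := K.
exists al, be, (c / g%:~R); split; first exact: divr_gt0.
  have -> : (n%:~R, k%:~R) = g%:~R *: (n1%:~R, k1%:~R) :> R * R.
    by rewrite ek en !intrM; congr pair; rewrite mulrC.
  by rewrite gaugeZ // gauge_int // -e gtr0_norm // ek en !intrM; ring.
move=> z; have -> : n%:~R * z.2 - k%:~R * z.1 =
    g%:~R * (n1%:~R * z.2 - k1%:~R * z.1) by rewrite ek en !intrM; ring.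
rewrite normrM (gtr0_norm gR) mulrA divfK ?lt0r_neq0 //.
have lS1 := kink_supports _ _ _ _ _ _ 1 c0 _ h.
have lS2 := kink_supports _ _ _ _ _ _ (- 1) c0 _ h.
rewrite normrN normr1 in lS1 lS2.
have := gauge_ge _ z _ K (lS1 (lexx _)); have := gauge_ge _ z _ K (lS2 (lexx _)).
by case: (ger0P (n1%:~R * z.2 - k1%:~R * z.1)) => /= _; lra.
Qed.

(** If the value were at most 0, adding the kink inequality at 0/1 for [z] and for [- z] would
    cancel the linear part and force [z.2 = 0]; then [z.1 = 0] because [N 0 1 > 0]. *)
Lemma gauge_gt0 N z : kinked N -> z != 0 -> 0 < gauge N z.
Proof.
move=> K; have [P _ _] := K; apply: contraR; rewrite -leNgt => z0.
have k01 : (0 : int, 1 : int) != (0, 0) by [].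
have [al [be [c [c0 e h]]]] := gauge_kink _ _ _ K k01.
have := gauge_int _ 0 1 K isT; have := P 0 1 isT => N0 gN.
rewrite gN mulr1 mulr0 addr0 in e.
have := h z; have := h (- z); rewrite gaugeN //= mul0r subr0 mul1r.
rewrite mul0r subr0 mul1r normrN => h1 h2.
have z2 : z.2 = 0.
  by apply/eqP; rewrite -normr_le0 -(pmulr_rle0 _ c0); lra.
rewrite z2 normr0 oppr0 !mulr0 !addr0 e in h1 h2.
have z1 : z.1 = 0 by nra.
by apply/eqP; case: z z1 z2 {z0 h h1 h2} => ? ? /= -> ->.
Qed.

Lemma gauge_lipschitz N z w : kinked N ->
  `|gauge N z - gauge N w| <= N 0 1 * `|z.1 - w.1| + N 1 0 * `|z.2 - w.2|.
Proof.
move=> K; have h x y : gauge N x - gauge N y <= gauge N (x - y).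
  by rewrite lerBlDr; have := gaugeD _ (x - y) y K; rewrite subrK.
have b x : gauge N x <= N 0 1 * `|x.1| + N 1 0 * `|x.2|.
  by apply: gauge_le => // l; apply: supports_le.
apply: le_trans (b (z - w)).
rewrite ler_norml h andbT lerNl opprB; apply: le_trans (h w z) _.
by rewrite -gaugeN // opprB.
Qed.

Lemma gauge_continuous N : kinked N -> continuous (gauge N).
Proof.
move=> K z; have [P _ _] := K.
have a0 := P 0 1 isT; have b0 := P 1 0 isT.
apply/cvgrPdist_le => e e0; pose d := e / (N 0 1 + N 1 0).
have d0 : 0 < d by rewrite divr_gt0 // addr_gt0.
have : \forall w \near z, ball z d w by apply: nbhsx_ballx.
apply: filterS => w [/= h1 h2].
apply: le_trans (gauge_lipschitz _ _ _ K) _.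
have -> : e = N 0 1 * d + N 1 0 * d.
  by rewrite -mulrDl /d mulrCA divff ?mulr1 // lt0r_neq0 // addr_gt0.
by apply: lerD; apply: ler_wpM2l; rewrite ltW.
Qed.

End Gauge.

(** * Strict convexity from the kinks in rational directions *)

Section Convexity.
Context {R : realType}.
Implicit Types (N : int -> int -> R) (p q : R * R).

(** Round the coordinates of [T * (p + q)] down to integers. By Cramer's rule the rounding errors
    change the coefficients of [p] and [q] by at most [b] divided by the absolute value of [d],
    which is [T - 1]. *)
Lemma cone_int_vector p q : p.1 * q.2 - p.2 * q.1 != 0 ->
  exists (k n : int) (x y : R), [/\ 0 < x, 0 < y,
    n%:~R = x * p.1 + y * q.1 & k%:~R = x * p.2 + y * q.2].
Proof.
set d := _ - _ => d0; have ad0 : 0 < `|d| by rewrite normr_gt0.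
pose b := `|p.1| + `|p.2| + `|q.1| + `|q.2|; pose T := 1 + b / `|d|.
pose n := Num.floor (T * (p.1 + q.1)); pose k := Num.floor (T * (p.2 + q.2)).
pose u1 := n%:~R - T * (p.1 + q.1); pose u2 := k%:~R - T * (p.2 + q.2).
have small (t : R) : `|(Num.floor t)%:~R - t| <= 1.
  have := floor_itv t; rewrite intrD mulr1z => /andP[? ?].
  by rewrite ler_norml; lra.
have pos (w : R * R) : `|w.1| + `|w.2| <= b -> 0 < T + (u1 * w.2 - u2 * w.1) / d.
  move=> wb; have h : `|u1 * w.2 - u2 * w.1| <= b.
    apply: le_trans (ler_normB _ _) (le_trans _ wb); rewrite !normrM addrC.
    by apply: lerD; rewrite ler_piMl // small.
  have : `|(u1 * w.2 - u2 * w.1) / d| <= b / `|d|.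
    by rewrite normrM normfV ler_pM2r // invr_gt0.
  by rewrite ler_norml /T; lra.
have [b1 b2] : `|q.1| + `|q.2| <= b /\ `|p.1| + `|p.2| <= b.
  have := (normr_ge0 p.1, normr_ge0 p.2); have := (normr_ge0 q.1, normr_ge0 q.2).
  by rewrite /b => -[? ?] [? ?]; lra.
exists k, n, (T + (u1 * q.2 - u2 * q.1) / d), (T - (u1 * p.2 - u2 * p.1) / d).
split; first exact: pos.
- by have := pos (- p); rewrite /= !normrN !mulrN -opprD mulNr; apply.
- by rewrite /u1 /u2 /d; field.
- by rewrite /u1 /u2 /d; field.
Qed.

Lemma gauge_lt1 N p q (l : R) : kinked N -> p != q ->
  gauge N p <= 1 -> gauge N q <= 1 -> 0 < l < 1 ->
  gauge N (l *: p + (1 - l) *: q) < 1.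
Proof.
move=> K pq Fp Fq /andP[l0 l1].
have [d0|d0] := eqVneq (p.1 * q.2 - p.2 * q.1) 0.
  (* On a line through the origin the gauge is a multiple of the absolute value, so the claim
     concerns an interval of reals. The vector [v] spans the line; if [p = 0], the roles of [p] and
     [q] are exchanged below. *)
  have collinear (v w : R * R) (s : R) : v != 0 -> v != w ->
    v.1 * w.2 - v.2 * w.1 = 0 -> gauge N v <= 1 -> gauge N w <= 1 ->
    0 < s -> s < 1 -> gauge N (s *: v + (1 - s) *: w) < 1.
    move=> v0 vw dvw Fv Fw s0 s1; have Fv0 := gauge_gt0 _ _ K v0.
    have [t wE] : exists t, w = t *: v.
      have [v1|v1] := eqVneq v.1 0; last first.
        exists (w.1 / v.1); case: v w v1 dvw {v0 vw Fv Fw Fv0} => [a b] [c d] /= v1 e.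
        congr pair => /=; first by rewrite /GRing.scale /= divfK.
        rewrite /GRing.scale /=; apply: (mulfI v1).
        by rewrite mulrA mulrCA divff // mulr1; lra.
      have v2 : v.2 != 0.
        by apply: contra v0 => /eqP v2; apply/eqP; case: v v1 v2 {vw dvw Fv Fv0} => ? ? /= -> ->.
      exists (w.2 / v.2); case: v w v1 v2 dvw {v0 vw Fv Fw Fv0} => [a b] [c d] /= a0 v2.
      rewrite a0 mul0r sub0r => /eqP; rewrite oppr_eq0 mulf_eq0 (negbTE v2) /= => /eqP ->.
      by congr pair; rewrite /GRing.scale /= ?mulr0 ?divfK.
    have t1 : t != 1.
      by apply: contra vw => /eqP t1; rewrite wE t1 scale1r.
    rewrite wE scalerA -scalerDl gaugeZ // -(gtr0_norm Fv0) -normrM.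
    rewrite wE gaugeZ // -(gtr0_norm Fv0) -normrM ler_norml in Fw.
    move/andP: Fw => [w1 w2]; move: Fv Fv0 w1 w2; move: (gauge N v) => f f1 f0 w1 w2.
    have tf : t * f != f.
      by apply: contra t1 => /eqP e; rewrite -(divff (lt0r_neq0 f0)) -{1}e mulfK ?lt0r_neq0.
    rewrite ltr_norml; apply/andP; split; nra.
  have [p0|p0] := eqVneq p 0; last exact: collinear.
  have qp : q != p by rewrite eq_sym.
  rewrite addrC -{2}(subKr 1 l); apply: collinear; rewrite -?p0 //; last 2 first.
  - by rewrite subr_gt0.
  - by rewrite gtrBl.
  by rewrite -[RHS]oppr0 -d0; ring.
have [k [n [x [y [x0 y0 nE kE]]]]] := cone_int_vector _ _ d0.
have kn0 : (k, n) != (0, 0).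
  apply: contra d0; rewrite xpair_eqE => /andP[/eqP k0 /eqP n0].
  rewrite -(mulrI_eq0 _ (mulfI (lt0r_neq0 x0))); apply/eqP.
  have -> : x * (p.1 * q.2 - p.2 * q.1) =
    (x * p.1 + y * q.1) * q.2 - (x * p.2 + y * q.2) * q.1 by ring.
  by rewrite -nE -kE n0 k0 !mul0r subrr.
have [al [be [c [c0 e h]]]] := gauge_kink _ _ _ K kn0.
(* The functional supporting at this integer vector is strictly below the gauge at [p], since [p]
   lies off its ray. *)
have Fv : gauge N (n%:~R, k%:~R) < x + y.
  rewrite -e nE kE.
  have hp : al * p.1 + be * p.2 < 1.
    apply: lt_le_trans Fp; apply: lt_le_trans (h p); rewrite ltrDl mulr_gt0 //.
    rewrite normr_gt0 nE kE.
    have -> : (x * p.1 + y * q.1) * p.2 - (x * p.2 + y * q.2) * p.1 =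
      - y * (p.1 * q.2 - p.2 * q.1) by ring.
    by rewrite mulf_neq0 // oppr_eq0 lt0r_neq0.
  have hq : al * q.1 + be * q.2 <= 1.
    by apply: le_trans Fq; apply: le_trans (h q); rewrite lerDl mulr_ge0 // ltW.
  have := ltr_pM2l x0 (al * p.1 + be * p.2) 1; rewrite hp mulr1.
  by have := ler_wpM2l (ltW y0) hq; rewrite mulr1; lra.
(* The multiple [ep] of the integer vector is split off from the convex combination. As
   [l * (1 - l)] is at most [l] and at most [1 - l], the coefficients left on [p] and [q] are
   nonnegative. *)
pose ep := l * (1 - l) / (x + y).
have xy0 : 0 < x + y by rewrite addr_gt0.
have ep0 : 0 < ep by rewrite divr_gt0 // mulr_gt0 // subr_gt0.
have epE : ep * (x + y) = l * (1 - l) by rewrite divfK ?lt0r_neq0.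
have e1 : 0 <= l - ep * x by nra.
have e2 : 0 <= 1 - l - ep * y by nra.
have -> : l *: p + (1 - l) *: q = ((l - ep * x) *: p + (1 - l - ep * y) *: q)
    + ep *: (n%:~R, k%:~R).
  rewrite nE kE; case: (p) (q) => [a b] [c' d]; congr pair.
    by rewrite /= /GRing.scale /=; ring.
  by rewrite /= /GRing.scale /=; ring.
apply: le_lt_trans (gaugeD _ _ _ K) _.
have := gaugeD _ ((l - ep * x) *: p) ((1 - l - ep * y) *: q) K.
rewrite !gaugeZ // !ger0_norm ?(ltW ep0) //.
have := ler_wpM2l e1 Fp; have := ler_wpM2l e2 Fq.
by have : ep * gauge N (n%:~R, k%:~R) < ep * (x + y); [rewrite ltr_pM2l | lra].
Qed.

End Convexity.

(** * The unit sphere of the norm as a polar curve, and the region it encloses *)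

Section UnitCurve.
Context {R : realType}.
Implicit Types (N : int -> int -> R) (p q z : R * R).

Definition unit_curve N : set (R * R) := [set z | gauge N z = 1].

Lemma enclosed_unit_curve N : kinked N ->
  enclosed (unit_curve N) = [set z | gauge N z <= 1].
Proof.
move=> K; apply/seteqP; split=> [_ [c /= c1] [l /andP[l0 l1] ->]|z /= z1] /=.
  by rewrite gaugeZ // c1 mulr1 ger0_norm.
have unit w : w != 0 -> gauge N ((gauge N w)^-1 *: w) = 1.
  move=> /(gauge_gt0 _ _ K) w0.
  by rewrite gaugeZ // gtr0_norm ?invr_gt0 // mulVf // lt0r_neq0.
have [->|z0] := eqVneq z 0.
  exists ((gauge N (1, 0))^-1 *: (1, 0)); last by exists 0; rewrite ?lexx ?ler01 ?scale0r.
  by apply: unit; rewrite xpair_eqE oner_eq0.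
exists ((gauge N z)^-1 *: z); first exact: unit.
exists (gauge N z); first by rewrite z1 gauge_ge0.
by rewrite scalerA divff ?scale1r // lt0r_neq0 // gauge_gt0.
Qed.

Lemma unit_curve_strictly_convex N : kinked N ->
  strictly_convex_curve (unit_curve N).
Proof.
move=> K; rewrite /strictly_convex_curve enclosed_unit_curve // => p q p1 q1 pq l l01.
have lt1 : gauge N (l *: p + (1 - l) *: q) < 1.
  by apply: gauge_lt1 => //; apply/eqP.
have : nbhs (l *: p + (1 - l) *: q) [set w | gauge N w < 1].
  exact: gauge_continuous K _ _ (lt_nbhsl lt1).
by apply: filterS => w /ltW.
Qed.

Lemma polar_angle z : z != 0 ->
  exists2 t, z = Num.sqrt (z.1 ^+ 2 + z.2 ^+ 2) *: (cos t, sin t) &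
    0 < Num.sqrt (z.1 ^+ 2 + z.2 ^+ 2).
Proof.
case: z => x y z0 /=; set d := Num.sqrt _.
have d0 : 0 < d.
  rewrite sqrtr_gt0 lt_neqAle addr_ge0 ?sqr_ge0 // andbT eq_sym.
  apply: contra z0; rewrite paddr_eq0 ?sqr_ge0 // !sqrf_eq0.
  by move=> /andP[/eqP -> /eqP ->].
have d2 : d ^+ 2 = x ^+ 2 + y ^+ 2 by rewrite sqr_sqrtr // addr_ge0 ?sqr_ge0.
have dn0 := lt0r_neq0 d0.
have u1 : -1 <= x / d <= 1.
  rewrite -ler_norml normrM normfV (gtr0_norm d0) ler_pdivrMr // mul1r.
  by rewrite -sqrtr_sqr; apply: ler_wsqrtr; rewrite lerDl sqr_ge0.
have s2 : sin (acos (x / d)) = `|y| / d.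
  rewrite sin_acos //; have -> : 1 - (x / d) ^+ 2 = (y / d) ^+ 2.
    by apply: (mulIf (expf_neq0 2 dn0)); rewrite mulrBl -!exprMn !divfK // mul1r d2; ring.
  by rewrite sqrtr_sqr normrM normfV (gtr0_norm d0).
have c2 : cos (acos (x / d)) = x / d by rewrite acosK.
have [y0|y0] := leP 0 y; [exists (acos (x / d)) | exists (- acos (x / d))] => //.
- by rewrite s2 c2 ger0_norm //; congr pair; rewrite /GRing.scale /= mulrC divfK.
- rewrite cosN sinN s2 c2 ltr0_norm // mulNr opprK.
  by congr pair; rewrite /GRing.scale /= mulrC divfK.
Qed.

Lemma cos_sin_neq0 (t : R) : (cos t, sin t) != 0 :> R * R.
Proof.
apply/eqP => -[c s]; have := cos2Dsin2 t.
by rewrite c s expr0n addr0 => /eqP; rewrite eq_sym oner_eq0.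
Qed.

Lemma periodic_int (f : R -> R) (T : R) : (forall t, f (t + T) = f t) ->
  forall t (j : int), f (t + j%:~R * T) = f t.
Proof.
move=> fT; have fn (n : nat) t : f (t + n%:R * T) = f t.
  elim: n t => [|n IH] t; first by rewrite mul0r addr0.
  by rewrite -natr1 mulrDl mul1r addrA fT IH.
move=> t j; case: (intP j) => [|n|n]; first by rewrite mul0r addr0.
  by rewrite -pmulrn fn.
by rewrite -[LHS](fn n.+1) rmorphN /= -pmulrn mulNr subrK.
Qed.

Lemma cos_sin_period (s t : R) : cos s = cos t -> sin s = sin t ->
  exists j : int, s = t + j%:~R * (2 * pi).
Proof.
move=> ec es; have p0 : 0 < 2 * pi :> R by rewrite mulr_gt0 ?pi_gt0.
pose j := Num.floor ((s - t) / (2 * pi)); exists j.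
pose u := s - t - j%:~R * (2 * pi).
have cosj : forall v (i : int), cos (v + i%:~R * (2 * pi)) = cos v :> R.
  by apply: periodic_int => v; rewrite mulr_natl cosD2pi.
have cu : cos u = 1.
  have := cosj (s - t) (- j); rewrite rmorphN mulNr -/u => ->.
  by rewrite cosB ec es -!expr2 cos2Dsin2.
have /andP[f1 f2] := floor_itv ((s - t) / (2 * pi)).
rewrite -/j ler_pdivlMr // in f1;
rewrite -/j intrD mulr1z ltr_pdivrMr // in f2.
have u0 : 0 <= u by rewrite /u; lra.
have u1 : u < 2 * pi by rewrite /u; lra.
suff : u = 0 by rewrite /u; lra.
have [up|up] := leP u pi.
  by apply: cos_inj; rewrite ?cos0 // in_itv /= ?u0 ?up ?lexx ?pi_ge0.
have : 2 * pi - u = 0.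
  apply: cos_inj; rewrite ?in_itv /= ?lexx ?pi_ge0 //; first by lra.
  have := cosj (- u) 1; rewrite mulr1z mul1r addrC cosN => ->.
  by rewrite cos0.
lra.
Qed.

Lemma unit_curve_neq0 N z : kinked N -> unit_curve N z -> z != 0.
Proof.
move=> K; apply: contraPneq => ->; rewrite /unit_curve /= -(scale0r 0) gaugeZ //.
by rewrite normr0 mul0r => /eqP; rewrite eq_sym oner_eq0.
Qed.

Lemma unit_curveE N : kinked N -> unit_curve N =
  [set ((gauge N (cos t, sin t))^-1 * cos t, (gauge N (cos t, sin t))^-1 * sin t)
     | t in [set: R]].
Proof.
move=> K; apply/seteqP; split=> [z z1|_ [t _ <-]] /=.
  have z0 : z != 0 by apply: unit_curve_neq0 z1.
  have [t zE d0] := polar_angle _ z0; exists t => //.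
  move: zE d0; set d := Num.sqrt _ => zE d0.
  have : d * gauge N (cos t, sin t) = 1.
    by rewrite -(gtr0_norm d0) -gaugeZ // -zE.
  move=> /(canRL (mulfK (lt0r_neq0 (gauge_gt0 _ _ K (cos_sin_neq0 t))))).
  by rewrite mul1r => <-; rewrite zE.
have g0 := gauge_gt0 _ _ K (cos_sin_neq0 t).
rewrite /unit_curve /= -[X in gauge N X]/((gauge N (cos t, sin t))^-1 *: (cos t, sin t)).
by rewrite gaugeZ // gtr0_norm ?invr_gt0 // mulVf // lt0r_neq0.
Qed.

Lemma gauge_cos_sin_continuous N : kinked N ->
  continuous (fun t : R => gauge N (cos t, sin t)).
Proof.
move=> K t; apply: (@continuous_comp _ _ _ (fun t => (cos t, sin t)) (gauge N)).
  exact: (cvg_pair (@continuous_cos R t) (@continuous_sin R t)).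
exact: gauge_continuous.
Qed.

Lemma unit_curve_polar N : kinked N -> continuous_polar_curve (unit_curve N).
Proof.
move=> K; exists (fun t => (gauge N (cos t, sin t))^-1); split=> [t|t|t|].
- by rewrite invr_gt0 gauge_gt0 // cos_sin_neq0.
- by rewrite mulr_natl cosD2pi sinD2pi.
- apply: cvgV; first by rewrite lt0r_neq0 // gauge_gt0 // cos_sin_neq0.
  exact: gauge_cos_sin_continuous.
- exact: unit_curveE.
Qed.

End UnitCurve.

(** * Uniqueness of the curve by density of the rational directions *)

Section Curve.
Context {R : realType}.
Implicit Types (N : int -> int -> R) (z : R * R).

Lemma eq_continuous_rat (a b : R) (f g : R -> R) : a < b ->
  {within `[a, b], continuous f} -> {within `[a, b], continuous g} ->
  (forall q : rat, a <= ratr q <= b -> f (ratr q) = g (ratr q)) ->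
  {in `[a, b], f =1 g}.
Proof.
move=> ab /subspace_continuousP cf /subspace_continuousP cg fg x xab.
apply/eqP; rewrite -subr_eq0; apply: contraT => ne0.
have e0 : 0 < `|f x - g x| by rewrite normr_gt0.
have c : f y - g y @[y --> within `[a, b]%classic (nbhs x)] --> f x - g x.
  by apply: cvgB; [exact: cf | exact: cg].
have hn : nbhs x [set y | `[a, b]%classic y -> `|(f x - g x) - (f y - g y)| < `|f x - g x|].
  exact: (proj1 (cvgrPdist_lt _ _) c).
have [d /= d0 h] := proj1 (nbhs_ballP _ _) hn.
move: xab; rewrite in_itv /= => /andP[ax xb].
(* This open interval is nonempty even when [x] is an endpoint of [[a, b]], so it contains a
   rational. *)
have : Num.max a (x - d) < Num.min b (x + d).
  by rewrite lt_min !gt_max ab /=; apply/and3P; split; lra.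
move=> /rat_in_itvoo[q]; rewrite in_itv /= lt_min gt_max.
move=> /andP[/andP[aq dq] /andP[qb qd]].
have qab : a <= ratr q <= b by rewrite !ltW.
have : ball x d (ratr q) by rewrite /ball /= ltr_norml; apply/andP; split; lra.
move=> /h; rewrite /= in_itv /= qab => /(_ isT).
by rewrite fg // subrr subr0 ltxx.
Qed.

Lemma unit_curve_points N k n : kinked N -> coprimez k n ->
  unit_curve N (n%:~R / N k n, k%:~R / N k n).
Proof.
move=> K co; have [P _ _] := K; have N0 := P k n co.
have -> : (n%:~R / N k n, k%:~R / N k n) = (N k n)^-1 *: (n%:~R, k%:~R) :> R * R.
  by congr pair; rewrite mulrC.
by rewrite /unit_curve /= gaugeZ // gauge_int // gtr0_norm ?invr_gt0 // mulVf ?lt0r_neq0.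
Qed.

(** The radius of [C] times the gauge of the unit direction is continuous, and it is 1 in every
    rational direction, hence everywhere. *)
Lemma unit_curve_unique N (C : set (R * R)) : kinked N ->
  continuous_polar_curve C ->
  (forall k n, coprimez k n -> C (n%:~R / N k n, k%:~R / N k n)) ->
  C = unit_curve N.
Proof.
move=> K [r [r0 rper rc CE]] CN; have [P _ _] := K.
pose h t := r t * gauge N (cos t, sin t).
have g0 t := gauge_gt0 _ _ K (cos_sin_neq0 t).
have rj := periodic_int _ _ rper.
(* The prescribed point in direction [t] is attained by [C] at some angle [u]. Comparing norms gives
   the radius at [u], and then [u] and [t] differ by a multiple of the period. *)
have hint t k n (s : R) : coprimez k n -> 0 < s ->
    cos t = s * n%:~R -> sin t = s * k%:~R -> h t = 1.
  move=> co s0 ct st; have N0 := P k n co.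
  have gE : gauge N (cos t, sin t) = s * N k n.
    have -> : (cos t, sin t) = s *: (n%:~R, k%:~R) :> R * R by rewrite ct st.
    by rewrite gaugeZ // gauge_int // gtr0_norm.
  have := CN k n co; rewrite CE => -[u _ [e1 e2]].
  have e1' : r u * cos u = (s * N k n)^-1 * cos t.
    by rewrite e1 ct; field; rewrite !lt0r_neq0.
  have e2' : r u * sin u = (s * N k n)^-1 * sin t.
    by rewrite e2 st; field; rewrite !lt0r_neq0.
  have ru : r u = (s * N k n)^-1.
    apply/eqP; rewrite -(@eqrXn2 _ 2) ?invr_ge0 ?(ltW (r0 u)) ?mulr_ge0 ?ltW //.
    rewrite -[X in X == _]mulr1 -[X in _ == X]mulr1 -{1}(cos2Dsin2 u) -(cos2Dsin2 t).
    by rewrite !mulrDr -!exprMn e1' e2'.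
  have inv0 : (s * N k n)^-1 != 0 by rewrite invr_neq0 // lt0r_neq0 // mulr_gt0.
  rewrite ru in e1' e2'; have cE := mulfI inv0 e1'; have sE := mulfI inv0 e2'.
  have [j uE] := cos_sin_period _ _ cE sE.
  by rewrite /h gE -(rj t j) -uE ru mulVf // -invr_eq0.
have hc : continuous h.
  move=> t; apply: cvgM; first exact: rc.
  exact: gauge_cos_sin_continuous.
have h1 t : h t = 1.
  have [c0|c0] := eqVneq (cos t) 0.
    have := cos2Dsin2 t; rewrite c0 expr0n add0r => /eqP.
    rewrite sqrf_eq1 => /orP[]/eqP s1.
      by apply: (hint t 1 0 1); rewrite // ?mulr0 // mulr1.
    by apply: (hint t (-1) 0 1); rewrite // ?mulr0 // mul1r mulrN1z.
  (* Up to a half turn [t] is the angle [b] of slope [y], so varying the slope [v] in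
     [t - b + atan v] meets a rational direction at every rational [v]. *)
  pose y := sin t / cos t; pose b := atan y.
  have ca0 (v : R) : 0 < cos (atan v).
    by rewrite cos_gt0_pihalf // atan_gtNpi2 atan_ltpi2.
  have sa (v : R) : sin (atan v) = v * cos (atan v).
    by rewrite -{2}(atanK v) /tan divfK // lt0r_neq0.
  have s0 : sin (t - b) = 0.
    by rewrite sinB /b sa /y; field.
  have e1 : cos (t - b) = 1 \/ cos (t - b) = -1.
    have := cos2Dsin2 (t - b); rewrite s0 expr0n addr0 => /eqP.
    by rewrite sqrf_eq1 => /orP[]/eqP; [left | right].
  pose f (v : R) := h (t - b + atan v).
  have fc : continuous f.
    move=> v; apply: (@continuous_comp _ _ _ (fun v => t - b + atan v) h); last exact: hc.
    by apply: cvgD; [exact: cvg_cst | exact: continuous_atan].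
  have : f y = 1.
    apply: (@eq_continuous_rat (y - 1) (y + 1) f (cst 1)); first by lra.
    - exact: continuous_subspaceT.
    - by apply: continuous_subspaceT => z; exact: cvg_cst.
    - move=> q _; rewrite /f /cst.
      have d0 : 0 < (denq q)%:~R :> R by rewrite ltr0z.
      have co : coprimez (numq q) (denq q) by rewrite coprimezE coprime_num_den.
      have s1 : 0 < cos (atan (ratr q)) / (denq q)%:~R :> R by rewrite divr_gt0.
      have qE : ratr q = (numq q)%:~R / (denq q)%:~R :> R by [].
      have dn0 := lt0r_neq0 d0.
      case: e1 => e1.
        apply: (hint _ (numq q) (denq q) _ co s1).
          by rewrite cosD e1 s0 divfK // mul0r subr0 mul1r.
        by rewrite sinD e1 s0 sa mul0r add0r {1}qE; field.
      apply: (hint _ (- numq q) (- denq q) _ _ s1).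
      + by rewrite coprimezN coprimeNz.
      + by rewrite cosD e1 s0 rmorphN mulrN divfK // mul0r subr0 mulN1r.
      + by rewrite sinD e1 s0 sa mul0r add0r {1}qE rmorphN /=; field.
    - by rewrite in_itv /=; apply/andP; split; lra.
  by rewrite /f -/b subrK.
have rE t : r t = (gauge N (cos t, sin t))^-1.
  by apply: (mulIf (lt0r_neq0 (g0 t))); rewrite mulVf ?lt0r_neq0 //; apply: h1.
rewrite unit_curveE // CE; congr image; apply/funext => t.
by rewrite rE.
Qed.

End Curve.

(** * The four continuous extensions and the arcs of the lattice curve *)

Section Extension.
Context {R : realType}.
Implicit Types (N : int -> int -> R).

Lemma gauge_extension N (c : R -> R * R) (f : rat -> R) : kinked N ->
  continuous c ->
  (forall q : rat, 0 <= q <= 1 -> gauge N (c (ratr q)) = f q) ->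
  unique_continuous_extension f (gauge N \o c).
Proof.
move=> K cc cf; have C : {within `[0, 1], continuous (gauge N \o c)}.
  apply: continuous_subspaceT => x; apply: continuous_comp; first exact: cc.
  exact: gauge_continuous.
split=> [//|G [Gc Gf]]; apply: eq_continuous_rat => // q.
move=> /andP[q0 q1]; have q01 : 0 <= q <= 1.
  by rewrite -(ler0q R) q0 -(ler_rat R) rmorph1.
by rewrite Gf // -cf.
Qed.

Lemma gauge_rat N (x y : int) (d : int) : kinked N -> coprimez x y -> 0 < d ->
  gauge N (y%:~R / d%:~R, x%:~R / d%:~R) = N x y / d%:~R.
Proof.
move=> K co d0; have dR : 0 < d%:~R :> R by rewrite ltr0z.
have -> : (y%:~R / d%:~R, x%:~R / d%:~R) = d%:~R^-1 *: (y%:~R, x%:~R) :> R * R.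
  by congr pair; rewrite mulrC.
by rewrite gaugeZ // gauge_int // gtr0_norm ?invr_gt0 // mulrC.
Qed.

(** Four sectors bounded by axes and diagonals cover the plane together with their negatives.
    Dividing a point by the absolute value of its dominant coordinate lands on the segment
    parametrizing the arc in that sector. *)
Lemma unit_curve_lattice N : kinked N -> unit_curve N =
  lattice_curve (fun x => gauge N (x, 1)) (fun x => gauge N (1, x))
                (fun x => gauge N (-1, x)) (fun x => gauge N (x, -1)).
Proof.
move=> K; rewrite /lattice_curve; set H := (X in _ = X `|` _).
have neg p : unit_curve N p -> unit_curve N (- p).
  by rewrite /unit_curve /= gaugeN.
have sc (u : R * R) : u != 0 -> unit_curve N (u.1 / gauge N u, u.2 / gauge N u).
  move=> u0; have g0 := gauge_gt0 _ _ K u0.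
  have -> : (u.1 / gauge N u, u.2 / gauge N u) = (gauge N u)^-1 *: u.
    by case: (u) => a b; congr pair; rewrite mulrC.
  by rewrite /unit_curve /= gaugeZ // gtr0_norm ?invr_gt0 // mulVf ?lt0r_neq0.
have nz1 (x : R) : (x, 1) != 0 :> R * R by rewrite xpair_eqE oner_eq0 andbF.
have nz2 (x : R) : (1, x) != 0 :> R * R by rewrite xpair_eqE oner_eq0.
have nz3 (x : R) : (-1, x) != 0 :> R * R by rewrite xpair_eqE oppr_eq0 oner_eq0.
have nz4 (x : R) : (x, -1) != 0 :> R * R.
  by rewrite xpair_eqE oppr_eq0 oner_eq0 andbF.
have HU p : H p -> unit_curve N p.
  move=> [[[]|]|] [x _ <-].
  - exact: (sc (x, 1)).
  - exact: (sc (1, x)).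
  - exact: (sc (-1, x)).
  - exact: (sc (x, -1)).
have ray (s : R) u : 0 < s -> unit_curve N (s * u.1, s * u.2) ->
    s = (gauge N u)^-1.
  move=> s0; rewrite /unit_curve /=.
  have -> : (s * u.1, s * u.2) = s *: u :> R * R by [].
  rewrite gaugeZ // gtr0_norm // => e; apply: (mulfI (lt0r_neq0 s0)).
  have g0 : gauge N u != 0.
    by apply/eqP => g0; move: e; rewrite g0 mulr0 => /eqP; rewrite eq_sym oner_eq0.
  by apply: (mulIf g0); rewrite -[RHS]mulrA mulVf // -mulrA e.
have in01 (x y : R) : 0 <= x -> x <= y -> 0 < y -> x / y \in `[0, 1].
  move=> x0 xy y0; rewrite in_itv /= divr_ge0 ?(ltW y0) //=.
  by rewrite ler_pdivrMr // mul1r.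
have half x y : unit_curve N (x, y) ->
    [\/ 0 < x /\ 0 <= y <= x, 0 < y /\ 0 <= x <= y,
        x < 0 /\ 0 <= y <= - x | y < 0 /\ 0 <= x <= - y] -> H (x, y).
  move=> xy [] [p /andP[q r]].
  - left; left; right; exists (y / x); first exact: in01.
    have e : x = (gauge N (1, y / x))^-1.
      by apply: ray => //=; rewrite mulr1 mulrCA divff ?lt0r_neq0 ?mulr1.
    by rewrite -e mul1r divfK ?lt0r_neq0.
  - left; left; left; exists (x / y); first exact: in01.
    have e : y = (gauge N (x / y, 1))^-1.
      by apply: ray => //=; rewrite mulr1 mulrCA divff ?lt0r_neq0 ?mulr1.
    by rewrite -e mul1r divfK ?lt0r_neq0.
  - have p' : 0 < - x by rewrite oppr_gt0.
    left; right; exists (y / - x); first exact: in01.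
    have e : - x = (gauge N (-1, y / - x))^-1.
      by apply: ray => //=; rewrite mulrN1 opprK mulrCA divff ?lt0r_neq0 ?mulr1.
    by rewrite -e mulN1r opprK divfK ?lt0r_neq0.
  - have p' : 0 < - y by rewrite oppr_gt0.
    right; exists (x / - y); first exact: in01.
    have e : - y = (gauge N (x / - y, -1))^-1.
      by apply: ray => //=; rewrite mulrN1 opprK mulrCA divff ?lt0r_neq0 ?mulr1.
    by rewrite -e mulN1r opprK divfK ?lt0r_neq0.
apply/seteqP; split=> [[x y] xy|p [/HU //|[q /HU + <-]]]; last exact: neg.
have xy' : unit_curve N (- x, - y) := neg _ xy.
have xy0 : 0 < `|x| + `|y|.
  have := unit_curve_neq0 _ _ K xy; rewrite xpair_eqE negb_and -!normr_gt0.
  by case/orP => h; [rewrite ltr_wpDr | rewrite ltr_wpDl].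
suff [h|h] : H (x, y) \/ H (- x, - y); [by left| |].
  by right; exists (- x, - y) => //=; congr pair; rewrite opprK.
move: xy0; have [x0|x0] := leP 0 x; have [y0|y0] := leP 0 y.
- have [yx|xy''] := leP y x; rewrite !ger0_norm // => s; left; apply: half => //.
    by apply: Or41; split; lra.
  by apply: Or42; split; lra.
- rewrite ger0_norm // ltr0_norm // => s; have [u|u] := leP x (- y).
    by left; apply: half => //; apply: Or44; split; lra.
  by right; apply: half => //; apply: Or43; split; lra.
- rewrite ltr0_norm // ger0_norm // => s; have [u|u] := leP y (- x).
    by left; apply: half => //; apply: Or43; split; lra.
  by right; apply: half => //; apply: Or44; split; lra.
- rewrite !ltr0_norm // => s; right; have [yx|yx] := leP (- y) (- x); apply: half => //.
    by apply: Or41; split; lra.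
  by apply: Or42; split; lra.
Qed.

End Extension.

(** * From labels to kinked functions, and invariance under sign changes *)

Section SignVariant.
Context {R : realType}.
Implicit Types (M : int -> int -> R) (m : region -> R).

Lemma hyperbolic_kinked M :
  hyperbolic_labels M -> kinked (fun k n => rho (M k n)).
Proof.
move=> H; have [E _ P _] := H; split=> [k n co|k n|k n co].
- by apply: rho_gt0; apply: P.
- by rewrite E.
- exact: rho_support.
Qed.

Lemma sign_variant_norm m m' p : sign_variant m m' -> `|m' p| = `|m p|.
Proof. by move=> [c [i [j [_ _ ->]]]]; case: ifP; rewrite ?normrN. Qed.

(* The three regions at a vertex have three different colours, so exactly two
   of the labels r, s, t change sign and rst is unchanged. *)
Lemma sign_variant_discriminator m m' k n k' n' : sign_variant m m' ->
  farey k n k' n' -> discriminator m' k n k' n' = discriminator m k n k' n'.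
Proof.
move=> [c [i [j [col ij mE]]]] h; rewrite /discriminator !mE.
have h2 := farey_addl _ _ _ _ h.
have h3 : farey k n (k + k') (n + n').
  by have := farey_add _ _ _ _ 1 h; rewrite !mul1r (addrC k') (addrC n').
have := col _ _ _ _ h; have := col _ _ _ _ h2; have := col _ _ _ _ h3.
move: (c _) (c _) (c _) ij => x z y + /eqP + /eqP + /eqP.
rewrite -!val_eqE /= => ij xz zy yx.
have := (ltn_ord i, ltn_ord j, (ltn_ord x, ltn_ord y, ltn_ord z)).
move=> [[i3 j3] [[x3 y3] z3]].
by case: ifP => ex; case: ifP => ey; case: ifP => ez; try ring; lia.
Qed.

End SignVariant.

(** * The lattice curve as the unit sphere of the norm attached to [m0] *)

Theorem theorem11p4 (R : realType) (m m0 : region -> R)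
    (m_top : markov_topograph m)
    (m0_top : markov_topograph m0)
    (m0_ge2 : forall p : region, 2 <= m0 p)
    (m0_well : has_well m0)
    (m_m0 : m = m0 \/ sign_variant m0 m) :
  (forall k n k' n' : int, farey k n k' n' -> discriminator m k n k' n' < 4) /\
  exists Phi0 Phi1 Phi2 Phi3 : R -> R,
    [/\ unique_continuous_extension (phi0 m) Phi0,
        unique_continuous_extension (phi1 m) Phi1,
        unique_continuous_extension (phi2 m) Phi2 &
        unique_continuous_extension (phi3 m) Phi3] /\
    exists Gamma : set (R * R),
      [/\ continuous_polar_curve Gamma /\ topograph_points m `<=` Gamma,
          forall C : set (R * R), continuous_polar_curve C ->
            topograph_points m `<=` C -> C = Gamma,
          Gamma = lattice_curve Phi0 Phi1 Phi2 Phi3 &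
          strictly_convex_curve Gamma].
Proof.
split=> [k n k' n' h|].
  have : discriminator m0 k n k' n' < 4 by apply: well_discriminator_lt4.
  by case: m_m0 => [->|sv] //; rewrite (sign_variant_discriminator _ _ _ _ _ _ sv).
(* The points and the four functions see [m] only through absolute values, so the rest of the
   argument can use [m0]. *)
have mE p : `|m p| = m0 p.
  have n0 : `|m0 p| = m0 p by rewrite ger0_norm // (le_trans _ (m0_ge2 p)).
  by case: m_m0 => [->|sv] //; rewrite (sign_variant_norm _ _ _ sv).
pose N k n := rho (m0 (reg k n)).
have K : kinked N.
  exact: (hyperbolic_kinked _ (topograph_hyperbolic_labels _ m0_top m0_ge2 m0_well)).
have co (q : rat) : coprimez (numq q) (denq q).
  by rewrite coprimezE coprime_num_den.
have den (q : rat) : 0 < denq q by [].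
have den1 (q : rat) : (denq q)%:~R / (denq q)%:~R = 1 :> R.
  by rewrite divff // intr_eq0.
(* By homogeneity, the gauge at a rational point of these segments is [N] at the primitive vector on
   the ray divided by the denominator, which is the required value. *)
exists (fun x => gauge N (x, 1)), (fun x => gauge N (1, x)),
  (fun x => gauge N (-1, x)), (fun x => gauge N (x, -1)); split; first split.
- apply: (@gauge_extension _ N (fun x => (x, 1))) => // [x|q _].
    exact: (cvg_pair cvg_id (cvg_cst _)).
  rewrite -(den1 q) /ratr gauge_rat // 1?coprimez_sym // /phi0 mE //.
- apply: (@gauge_extension _ N (fun x => (1, x))) => // [x|q _].
    exact: (cvg_pair (cvg_cst _) cvg_id).
  rewrite -(den1 q) /ratr gauge_rat // /phi1 mE //.
- apply: (@gauge_extension _ N (fun x => (-1, x))) => // [x|q _].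
    exact: (cvg_pair (cvg_cst _) cvg_id).
  (* Evenness of the gauge moves the sign to the numerator, where [phi2] has it. *)
  have -> : (-1, ratr q) = - (1, - ratr q) :> R * R by congr pair; rewrite opprK.
  rewrite gaugeN // -(den1 q) /ratr -mulNr -rmorphN gauge_rat //.
    by rewrite /phi2 mE.
  by rewrite coprimeNz.
- apply: (@gauge_extension _ N (fun x => (x, -1))) => // [x|q _].
    exact: (cvg_pair cvg_id (cvg_cst _)).
  rewrite -(den1 q) /ratr -mulNr -rmorphN gauge_rat //.
    by rewrite /phi3 mE.
  by rewrite coprimeNz coprimez_sym.
have PE C : topograph_points m `<=` C <->
    forall k n, coprimez k n -> C (n%:~R / N k n, k%:~R / N k n).
  split=> [h k n kn|h _ [k [n [kn ->]]]].
    by apply: h; exists k, n; rewrite mE.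
  by rewrite mE; apply: h.
exists (unit_curve N); split.
- split; first exact: unit_curve_polar.
  by apply/PE => k n; apply: unit_curve_points.
- by move=> C Cp /PE; apply: unit_curve_unique.
- exact: unit_curve_lattice.
- exact: unit_curve_strictly_convex.
Qed.
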